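(* Let $U \subset \mathbb{C}$ be a connected open neighborhood of $\overline{\mathbb{D}}$, and let $f$ be a holomorphic function on $U$ that is not identically zero and whose zero set in $U$ is non-empty. Let $p_1,\dots,p_m \in \mathbb{D}$ be all the (distinct) zeros of $f$ in $\mathbb{D}$, with multiplicities $k_1,\dots,k_m$, and let $q_1,\dots,q_r \in \partial\mathbb{D}$ be all the (distinct) zeros of $f$ on $\partial \mathbb{D}$, with multiplicities $\ell_1,\dots,\ell_r$. For $\varepsilon>0$ set $\Gamma_\varepsilon := \{z\in\mathbb{D}: |f(z)|=\varepsilon\}$ and $E_\varepsilon := \{z\in\mathbb{D}: |f(z)|<\varepsilon\}$. Then there exist positive constants $C_j, C_j'$ ($1\le j\le m$) and $D_\nu, D_\nu'$ ($1\le\nu\le r$) such that, for all sufficiently small $\varepsilon>0$, $$\mathcal{H}^1(\Gamma_\varepsilon) \le \sum_{j=1}^m C_j\, \varepsilon^{1/k_j} + \sum_{\nu=1}^r D_\nu\, \varepsilon^{1/\ell_\nu}$$ and $$\operatorname{Area}(E_\varepsilon) \le \sum_{j=1}^m C_j'\, \varepsilon^{2/k_j} + \sum_{\nu=1}^r D_\nu'\, \varepsilon^{2/\ell_\nu}.$$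
   Context: $\mathbb{D}=\{z\in\mathbb{C}:|z|<1\}$ is the unit disk. $\mathcal{H}^1$ is one-dimensional Hausdorff measure and $\operatorname{Area}$ is two-dimensional Lebesgue measure on $\mathbb{C}\cong\mathbb{R}^2$. Either of the two lists of zeros may be empty, in which case the corresponding sums are $0$. *)

(* Defs.v *)
From HB Require Import structures.
From mathcomp Require Import all_boot all_order all_algebra.
From mathcomp Require Import complex.
From mathcomp Require Import all_classical all_reals all_analysis.
Set Implicit Arguments.
Unset Strict Implicit.
Unset Printing Implicit Defensive.
Import Order.TTheory GRing.Theory Num.Theory numFieldNormedType.Exports.
Import ComplexField.Normc.
Local Open Scope classical_set_scope.
Local Open Scope ring_scope.
Local Open Scope complex_scope.

(* C is the complex field with the topology of its modulus; derivatives of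
   maps between the one-dimensional R[i]-normed modules C are complex ones. *)
Notation C R := (R[i]^o).

Definition unit_disk (R : realType) : set (C R) := [set z | normc z < 1].

Definition unit_circle (R : realType) : set (C R) := [set z | normc z = 1].

Definition closed_unit_disk (R : realType) : set (C R) :=
  [set z | normc z <= 1].

Definition holomorphic_on (R : realType) (U : set (C R)) (f : C R -> C R) :=
  forall z, U z -> derivable f z 1.

Definition zero_of_multiplicity (R : realType) (f : C R -> C R) (p : C R)
    (k : nat) :=
  (0 < k)%N /\
  exists (V : set (C R)) (g : C R -> C R),
    [/\ open V, V p, holomorphic_on V g, g p != 0 &
        forall z, V z -> f z = (z - p) ^+ k * g z].

(* The point 0 is thrown in so that the empty set has diameter 0, not -oo. *)
Definition diam (R : realType) (A : set (C R)) : \bar R :=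
  ereal_sup (0%E |` [set (normc (xy.1 - xy.2))%:E | xy in A `*` A]).

Definition hausdorff1_pre (R : realType) (d : R) (A : set (C R)) : \bar R :=
  ereal_inf [set (\sum_(0 <= n <oo) diam (F n))%E | F in
    [set F : nat -> set (C R) |
      A `<=` \bigcup_n F n /\ forall n, (diam (F n) <= d%:E)%E]].

Definition hausdorff1 (R : realType) (A : set (C R)) : \bar R :=
  ereal_sup [set hausdorff1_pre d A | d in [set d : R | 0 < d]].

Definition area (R : realType) (A : set (C R)) : \bar R :=
  (@lebesgue_measure R \x @lebesgue_measure R)%E
    [set xy | A (xy.1 +i* xy.2)].

Definition level_set (R : realType) (f : C R -> C R) (e : R) : set (C R) :=
  [set z | unit_disk z /\ normc (f z) = e].

Definition sublevel_set (R : realType) (f : C R -> C R) (e : R) : set (C R) :=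
  [set z | unit_disk z /\ normc (f z) < e].

(* Main.v *)
(* Near a zero a of multiplicity k write f = (z - a)^k g with g(a) != 0.
   If g is M-Lipschitz near a, two points z, w of {|f| = e} near a satisfy
   (|w - a|^k - |z - a|^k) |g(w)| = |z - a|^k (|g(z)| - |g(w)|), hence
   ||z - a| - |w - a|| <= |z - w| / 2.  So the level set is a Lipschitz graph in
   polar coordinates over a circle of radius O(e^(1/k)), and the sublevel set
   lies in a square of that size; compactness of the closed disk confines both
   sets to such neighbourhoods of the zeros.

   That g, merely complex differentiable, is locally Lipschitz is a Cauchy
   estimate for g'.  It is obtained without integrals: boundary Riemann sums
   over dyadic subdivisions are exactly additive under quartering of squares,
   so Goursat's bisection applies to them directly, and it is used for
   (g(z) - g(a) - g'(a)(z - a)) / (z - a)^2 on squares centred at a. *)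
Require Import Defs.
From HB Require Import structures.
From mathcomp Require Import all_boot all_order all_algebra.
From mathcomp Require Import complex ring lra.
From mathcomp Require Import all_classical all_reals all_analysis measurable_realfun.
Set Implicit Arguments.
Unset Strict Implicit.
Unset Printing Implicit Defensive.
Import Order.TTheory GRing.Theory Num.Theory numFieldNormedType.Exports.
Import ComplexField.Normc.
Local Open Scope classical_set_scope.
Local Open Scope ring_scope.
Local Open Scope complex_scope.
Local Notation Re := complex.Re.
Local Notation Im := complex.Im.

(** * Elementary properties of the complex modulus *)

Section Modulus.
Variable R : realType.
Implicit Types (x y z w : R[i]) (r : R).

Lemma normc_ge0 z : 0 <= normc z.
Proof. by case: z => a b; exact: sqrtr_ge0. Qed.

Lemma normc_triangle x y : normc (x + y) <= normc x + normc y.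
Proof. exact: (@le_normcD R x y). Qed.

Lemma normc_opp z : normc (- z) = normc z.
Proof. exact: (@normcN R z). Qed.

Lemma normc_distC x y : normc (x - y) = normc (y - x).
Proof. by rewrite -normc_opp opprB. Qed.

Lemma normc_sub_triangle x y z : normc (x - z) <= normc (x - y) + normc (y - z).
Proof. by apply: le_trans (normc_triangle _ _); rewrite addrA subrK. Qed.

Lemma normc_subl x y : normc x - normc y <= normc (x - y).
Proof. by rewrite lerBlDr; apply: le_trans (normc_triangle _ _); rewrite subrK. Qed.

Lemma normc_eq0 z : (normc z == 0) = (z == 0).
Proof. by apply/eqP/eqP => [/eq0_normc//|->]; exact: normc0. Qed.

Lemma normc_gt0 z : (0 < normc z) = (z != 0).
Proof. by rewrite lt_neqAle normc_ge0 andbT eq_sym normc_eq0. Qed.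

Lemma normcX z n : normc (z ^+ n) = normc z ^+ n.
Proof. by elim: n => [|n ih]; rewrite ?expr0 ?exprS ?normcM ?ih //; exact: normc1. Qed.

Lemma normc_real r : normc r%:C = `|r|.
Proof. by rewrite /= expr0n addr0 sqrtr_sqr. Qed.

Lemma normc_i : normc ('i : R[i]) = 1.
Proof. by rewrite /= expr0n expr1n add0r sqrtr1. Qed.

Lemma normc_Re z : `|Re z| <= normc z.
Proof. by case: z => a b /=; rewrite -sqrtr_sqr ler_wsqrtr // lerDl sqr_ge0. Qed.

Lemma normc_Im z : `|Im z| <= normc z.
Proof. by case: z => a b /=; rewrite -sqrtr_sqr ler_wsqrtr // lerDr sqr_ge0. Qed.

Lemma normc_le_ReIm z : normc z <= `|Re z| + `|Im z|.
Proof.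
rewrite {1}(complexE z); apply: le_trans (normc_triangle _ _) _.
by rewrite normcM normc_i mul1r !normc_real.
Qed.

End Modulus.

(** * Bisection as a substitute for compactness *)

Section Bisection.
Variable R : realType.
Implicit Types (a b s t u v x y : R).

(* Nested squares that violate P shrink to a point where the local hypothesis
   applies. *)
Lemma square_bisection (P : R -> R -> R -> Prop) a b t : 0 < t ->
  (forall x y s, 0 < s ->
     P x y (s / 2) -> P (x + s / 2) y (s / 2) -> P x (y + s / 2) (s / 2) ->
     P (x + s / 2) (y + s / 2) (s / 2) -> P x y s) ->
  (forall u v, a <= u <= a + t -> b <= v <= b + t ->
     exists2 d, 0 < d & forall x y s, 0 < s < d ->
       a <= x -> x + s <= a + t -> b <= y -> y + s <= b + t ->
       x <= u <= x + s -> y <= v <= y + s -> P x y s) ->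
  P a b t.
Proof.
move=> t0 P4 Ploc; apply: contrapT => nP.
(* The premises sit inside the subset type because [dependent_choice] asks for a successor of every
   triple; a degenerate or good square returns itself. *)
have half (c : R * R * R) : {c' : R * R * R |
    0 < c.2 -> ~ P c.1.1 c.1.2 c.2 ->
    [/\ c'.2 = c.2 / 2, c.1.1 <= c'.1.1 <= c.1.1 + c.2 / 2,
        c.1.2 <= c'.1.2 <= c.1.2 + c.2 / 2 & ~ P c'.1.1 c'.1.2 c'.2]}.
  case: c => -[x y] s /=; apply: cid.
  have [s0|s0] := ltP 0 s; last by exists (x, y, s) => s1; lra.
  have [Px|Px] := pselect (P x y s); first by exists (x, y, s).
  have := P4 x y s s0.
  have [P1|P1] := pselect (P x y (s / 2)); last first.
    by move=> _; exists (x, y, s / 2) => _ _ /=; split=> //; lra.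
  have [P2|P2] := pselect (P (x + s / 2) y (s / 2)); last first.
    by move=> _; exists (x + s / 2, y, s / 2) => _ _ /=; split=> //; lra.
  have [P3|P3] := pselect (P x (y + s / 2) (s / 2)); last first.
    by move=> _; exists (x, y + s / 2, s / 2) => _ _ /=; split=> //; lra.
  have [P5|P5] := pselect (P (x + s / 2) (y + s / 2) (s / 2)); last first.
    by move=> _; exists (x + s / 2, y + s / 2, s / 2) => _ _ /=; split=> //; lra.
  by move=> /(_ P1 P2 P3 P5).
have [F [F0 FS]] := dependent_choice half (a, b, t).
have Fn n : (F n).2 = t * (1 / 2 ^+ n) /\ ~ P (F n).1.1 (F n).1.2 (F n).2.
  elim: n => [|n [ih1 ih2]]; first by rewrite F0 expr0 divr1 mulr1.
  have s0 : 0 < (F n).2 by rewrite ih1 mulr_gt0 // mul1r invr_gt0 exprn_gt0.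
  have [e _ _ nP'] := FS n s0 ih2; split => //; rewrite e ih1 exprS.
  have : (2 ^+ n : R) != 0 by rewrite expf_neq0.
  by move=> n0; field.
have s0 n : 0 < (F n).2 by rewrite (Fn n).1 mulr_gt0 // mul1r invr_gt0 exprn_gt0.
have step n := FS n (s0 n) (Fn n).2.
have nest n m : [/\ (F n).1.1 <= (F (m + n)%N).1.1,
    (F (m + n)%N).1.1 + (F (m + n)%N).2 <= (F n).1.1 + (F n).2,
    (F n).1.2 <= (F (m + n)%N).1.2 &
    (F (m + n)%N).1.2 + (F (m + n)%N).2 <= (F n).1.2 + (F n).2].
  elim: m => [|m [i1 i2 i3 i4]]; first by split.
  have [e /andP[h1 h2] /andP[h3 h4] _] := step (m + n)%N.
  by rewrite addSn e; split; lra.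
have nest2 n m : (F n).1.1 <= (F m).1.1 + (F m).2 /\
                 (F n).1.2 <= (F m).1.2 + (F m).2.
  have [h|/ltnW h] := leqP n m.
    have [i1 i2 i3 i4] := nest n (m - n)%N; rewrite subnK // in i1 i2 i3 i4.
    by have := s0 m; split; lra.
  have [i1 i2 i3 i4] := nest m (n - m)%N; rewrite subnK // in i1 i2 i3 i4.
  by have := s0 n; split; lra.
(* By [nest2] every lower left corner is dominated by every upper right one, so the suprema of the
   corner coordinates lie in all the squares. *)
pose X := range (fun n => (F n).1.1); pose Y := range (fun n => (F n).1.2).
have inX n : (F n).1.1 <= sup X <= (F n).1.1 + (F n).2.
  apply/andP; split.
    apply: ub_le_sup; last by exists n.
    by exists ((F n).1.1 + (F n).2) => _ [m _ <-]; exact: (nest2 m n).1.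
  apply: ge_sup; first by exists ((F 0%N).1.1); exists 0%N.
  by move=> _ [m _ <-]; exact: (nest2 m n).1.
have inY n : (F n).1.2 <= sup Y <= (F n).1.2 + (F n).2.
  apply/andP; split.
    apply: ub_le_sup; last by exists n.
    by exists ((F n).1.2 + (F n).2) => _ [m _ <-]; exact: (nest2 m n).2.
  apply: ge_sup; first by exists ((F 0%N).1.2); exists 0%N.
  by move=> _ [m _ <-]; exact: (nest2 m n).2.
have := inX 0%N; have := inY 0%N; rewrite F0 /= => hY hX.
have [d d0 Pd] := Ploc _ _ hX hY.
have dt0 : 0 < d / t by rewrite divr_gt0.
(* [N] is chosen with 1 / 2^N < d / t, which brings the side of the [N]-th square below [d]. *)
have [N _ /(_ N (leqnn N)) /=] := near_infty_natSinv_expn_lt (PosNum dt0).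
rewrite ltr_pdivlMr // mulrC => sN.
have [i1 i2 i3 i4] := nest 0%N N; rewrite addn0 F0 /= in i1 i2 i3 i4.
by apply: (Fn N).2; apply: Pd => //; rewrite s0 /= (Fn N).1.
Qed.

(** The square bisection applied to a predicate that ignores the second coordinate. *)
Lemma interval_bisection (P : R -> R -> Prop) a t : 0 < t ->
  (forall x s, 0 < s -> P x (s / 2) -> P (x + s / 2) (s / 2) -> P x s) ->
  (forall u, a <= u <= a + t -> exists2 d, 0 < d & forall x s, 0 < s < d ->
       a <= x -> x + s <= a + t -> x <= u <= x + s -> P x s) ->
  P a t.
Proof.
move=> t0 P2 Ploc.
apply: (@square_bisection (fun x _ s => P x s) a a t) => //.
  by move=> x y s s0 p1 p2 _ _; exact: P2.
move=> u v /Ploc[d d0 Pd] _; exists d => // x y s sd ax xt _ _ xu _.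
exact: Pd.
Qed.

End Bisection.

(** * Riemann sums over boundaries of squares and Goursat's lemma *)

Section BoundarySums.
Variable R : realType.
Implicit Types (a b s t u v x y M c : R) (phi psi : R -> R[i]) (h k : R[i] -> R[i]).

(* Left-endpoint Riemann sum of phi over [a, a + s] with 2 ^ n pieces. *)
Fixpoint rsum n phi a s : R[i] :=
  if n is m.+1 then rsum m phi a (s / 2) + rsum m phi (a + s / 2) (s / 2)
  else s%:C * phi a.

Lemma rsumB n phi psi a s :
  rsum n (fun t => phi t - psi t) a s = rsum n phi a s - rsum n psi a s.
Proof.
elim: n a s => [|n ih] a s /=; first by rewrite mulrBr.
by rewrite !ih opprD addrACA.
Qed.

Lemma rsumZ n (z : R[i]) phi a s :
  rsum n (fun t => z * phi t) a s = z * rsum n phi a s.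
Proof.
elim: n a s => [|n ih] a s /=; first by rewrite mulrCA.
by rewrite !ih mulrDr.
Qed.

Lemma rsum_const n (z : R[i]) a s : rsum n (fun=> z) a s = s%:C * z.
Proof.
elim: n a s => [|n ih] a s //=.
by rewrite !ih -mulrDl -rmorphD /= -splitr.
Qed.

Lemma rsum_le n phi a s M : 0 <= s ->
  (forall t, a <= t <= a + s -> normc (phi t) <= M) ->
  normc (rsum n phi a s) <= M * s.
Proof.
elim: n a s => [|n ih] a s s0 phiM /=.
  rewrite normcM normc_real ger0_norm // mulrC ler_wpM2r //.
  by apply: phiM; lra.
apply: le_trans (normc_triangle _ _) _.
rewrite [s in leRHS](splitr s) mulrDr lerD //; apply: ih; try lra.
  by move=> t ht; apply: phiM; lra.
by move=> t ht; apply: phiM; lra.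
Qed.

Lemma rsum_Im_ge n phi a s c : 0 <= s ->
  (forall t, a <= t <= a + s -> c <= Im (phi t)) ->
  c * s <= Im (rsum n phi a s).
Proof.
elim: n a s => [|n ih] a s s0 phic /=.
  have : c <= Im (phi a) by apply: phic; lra.
  by case: (phi a) => p q /= cq; rewrite mul0r addr0 mulrC ler_wpM2l.
rewrite [s in leLHS](splitr s) mulrDr (raddfD (@complex.Im R : Rcomplex R -> R)).
by rewrite lerD //; apply: ih; try lra; move=> t ht; apply: phic; lra.
Qed.

(* Riemann sums of the contour integral of h around the square
   [x, x + s] * [y, y + s]. *)
Definition bsum n h x y s : R[i] :=
  rsum n (fun t => h (t +i* y) - h (t +i* (y + s))) x s +
  'i * rsum n (fun t => h ((x + s) +i* t) - h (x +i* t)) y s.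

Lemma bsumB n h k x y s :
  bsum n (fun z => h z - k z) x y s = bsum n h x y s - bsum n k x y s.
Proof. rewrite /bsum !rsumB; ring. Qed.

Lemma bsumZ n (c : R[i]) h x y s :
  bsum n (fun z => c * h z) x y s = c * bsum n h x y s.
Proof. rewrite /bsum !rsumB !rsumZ; ring. Qed.

Lemma complex_addr x y s : (x + s) +i* y = (x +i* y) + s%:C.
Proof. by simpc. Qed.

Lemma complex_addi x y s : x +i* (y + s) = (x +i* y) + 'i * s%:C.
Proof. by simpc. Qed.

(** The sum vanishes exactly at every level: the differences across opposite edges are the constants
    -d i s and d s, and the two contributions cancel. *)
Lemma bsum_affine n (c d : R[i]) x y s : bsum n (fun z => c + d * z) x y s = 0.
Proof.
rewrite /bsum.
have -> : (fun t => c + d * (t +i* y) - (c + d * (t +i* (y + s)))) =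
          (fun=> - (d * 'i * s%:C)).
  by apply/funext => t; rewrite complex_addi; ring.
have -> : (fun t => c + d * ((x + s) +i* t) - (c + d * (x +i* t))) =
          (fun=> d * s%:C).
  by apply/funext => t; rewrite complex_addr; ring.
rewrite !rsum_const; ring.
Qed.

(** Adjacent quarters sample their common edge at the same dyadic points with opposite signs, so the
    inner edges cancel without any limit. *)
Lemma bsumS n h x y s : bsum n.+1 h x y s =
  bsum n h x y (s / 2) + bsum n h (x + s / 2) y (s / 2) +
  bsum n h x (y + s / 2) (s / 2) + bsum n h (x + s / 2) (y + s / 2) (s / 2).
Proof.
have E z : z + s / 2 + s / 2 = z + s by lra.
rewrite /bsum /= !rsumB !E; ring.
Qed.

(** The bound is asked on the four edges only, so that [h] may be singular at the centre of the
    square. *)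
Lemma bsum_le n h x y s M : 0 <= s ->
  (forall u v, x <= u <= x + s -> y <= v <= y + s ->
     [|| u == x, u == x + s, v == y | v == y + s] -> normc (h (u +i* v)) <= M) ->
  normc (bsum n h x y s) <= 4 * M * s.
Proof.
move=> s0 hM; have -> : 4 * M * s = (M + M) * s + (M + M) * s by ring.
rewrite /bsum; apply: le_trans (normc_triangle _ _) _.
rewrite normcM normc_i mul1r lerD //; apply: rsum_le => // t ht;
  (apply: le_trans (normc_triangle _ _) _); rewrite normc_opp lerD // hM
    ?eqxx ?orbT //; lra.
Qed.

(** Differentiability as a remainder estimate with real tolerances; the remainder is then fed
    directly to [bsum_le]. *)
Definition cderiv h (z L : R[i]) := forall e, 0 < e ->
  exists2 d, 0 < d & forall w, normc (w - z) < d ->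
    normc (h w - h z - L * (w - z)) <= e * normc (w - z).

(** The first-order Taylor polynomial contributes nothing by [bsum_affine], so near a point only the
    remainder counts, which is small compared with the area; bounds proportional to the area add up
    under quartering. *)
Lemma goursat h x y s : 0 < s ->
  (forall u v, x <= u <= x + s -> y <= v <= y + s -> exists L, cderiv h (u +i* v) L) ->
  forall e, 0 < e -> \forall n \near \oo, normc (bsum n h x y s) <= e.
Proof.
move=> s0 hd e e0.
suff : \forall n \near \oo, normc (bsum n h x y s) <= e / s ^+ 2 * s ^+ 2.
  by rewrite divfK // expf_neq0 // gt_eqF.
have : 0 < e / s ^+ 2 by rewrite divr_gt0 // exprn_gt0.
move: (e / s ^+ 2) => {e0}e e0.
pose P x y s := \forall n \near \oo, normc (bsum n h x y s) <= e * s ^+ 2.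
apply: (@square_bisection R P) => //.
  move=> {hd s0 x y s} x y s s0 [N1 _ H1] [N2 _ H2] [N3 _ H3] [N4 _ H4].
  (* The successor accounts for [bsumS]: level [n.+1] on a square is level [n] on its quarters. *)
  exists (maxn N1 (maxn N2 (maxn N3 N4))).+1 => // -[//|n] /=.
  rewrite ltnS !geq_max => /and4P[/H1/= {}H1 /H2/= {}H2 /H3/= {}H3 /H4/= {}H4].
  rewrite bsumS.
  have := normc_triangle (bsum n h x y (s / 2) + bsum n h (x + s / 2) y (s / 2) +
    bsum n h x (y + s / 2) (s / 2)) (bsum n h (x + s / 2) (y + s / 2) (s / 2)).
  have := normc_triangle (bsum n h x y (s / 2) + bsum n h (x + s / 2) y (s / 2))
    (bsum n h x (y + s / 2) (s / 2)).
  have := normc_triangle (bsum n h x y (s / 2)) (bsum n h (x + s / 2) y (s / 2)).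
  have : e * (s / 2) ^+ 2 * 4 = e * s ^+ 2 by field.
  lra.
move=> u v hu hv; have [L hL] := hd u v hu hv.
(* Points of a square of side s' are within 2 s' of each other, so the remainder is at most (e / 8)
   2 s', and a perimeter of 4 s' gives e s'^2. *)
have e80 : 0 < e / 8 by rewrite divr_gt0.
have [d d0 hLd] := hL _ e80.
exists (d / 2) => [|x' y' s' s'0 _ _ _ _ hu' hv']; first by rewrite divr_gt0.
apply: nearW => n; set z0 : R[i] := u +i* v in hLd.
rewrite -[bsum _ _ _ _ _]subr0 -(bsum_affine n (h z0 - L * z0) L x' y' s') -bsumB.
apply: le_trans (@bsum_le _ _ _ _ _ (e / 8 * (2 * s')) _ _) _; first lra; last first.
  by rewrite le_eqVlt; apply/orP; left; apply/eqP; field.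
move=> u1 v1 hu1 hv1 _.
have nle : normc ((u1 +i* v1) - z0) <= 2 * s'.
  apply: le_trans (normc_le_ReIm _) _ => /=.
  have : `|u1 - u| <= s' by rewrite ler_norml; lra.
  have : `|v1 - v| <= s' by rewrite ler_norml; lra.
  lra.
rewrite (_ : _ - _ = h (u1 +i* v1) - h z0 - L * ((u1 +i* v1) - z0)); last by ring.
apply: le_trans (hLd _ _) _; first lra.
by rewrite ler_wpM2l // ltW.
Qed.

End BoundarySums.

(** * Cauchy estimate for the derivative *)

Section CauchyEstimate.
Variable R : realType.
Implicit Types (s t u x y M c e : R) (g : C R -> C R) (z w L : R[i]).

Lemma derivable_cderiv g z : derivable g z 1 -> exists L, cderiv g z L.
Proof.
move=> /cvg_ex[L gL]; exists L => e e0.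
have eC0 : (0 : R[i]) < e%:C by rewrite ltcR.
have /cvgrPdist_le/(_ _ eC0)[d /= d0 hd] := gL.
(* A positive element of [R[i]] is real, hence equal to its modulus. *)
have dR : d = (normc d)%:C by rewrite -[LHS]ger0_norm // ltW.
have d0' : 0 < normc d by move: d0; rewrite {1}dR -[0]/(0%:C) ltcR.
exists (normc d) => // w wd.
have [->|wz] := eqVneq w z.
  by rewrite !subrr mulr0 subrr normc0 mulr0.
have := hd (w - z); rewrite /ball_ /= sub0r normrN subr_eq0 wz.
rewrite -[`|w - z|]/((normc (w - z))%:C) {1}dR ltcR wd => /(_ isT isT).
rewrite -[`|_|]/((normc _)%:C) lecR => H.
have nwz : 0 < normc (w - z) by rewrite normc_gt0 subr_eq0.
rewrite -ler_pdivrMr // -normcV -normcM.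
apply: le_trans H; rewrite -[leRHS]normc_opp opprB le_eqVlt; apply/orP; left; apply/eqP.
congr normc; rewrite /shift /= -[_ *: 1]/(_ * 1) mulr1 subrK -[_ *: _]/(_ * _).
by field; rewrite subr_eq0.
Qed.

(** Makes [goursat] applicable to the second-order difference quotient away from [a]; the square is
    written as a product of inverses to match the derivation rules. *)
Lemma derivable_dquot2 (g : C R -> C R) (a w L : C R) :
  w != a -> derivable g w 1 ->
  derivable (fun z : C R =>
    (g z - g a) * ((z - a)^-1 * (z - a)^-1) - L * (z - a)^-1 : C R) w 1.
Proof.
move=> wa gd.
have dsub : derivable (@id (C R) - cst a) w 1.
  by apply: derivableB; [exact: derivable_id|exact: derivable_cst].
have wa0 : (@id (C R) - cst a) w != 0 by rewrite subr_eq0.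
have dK := derivableV wa0 dsub.
have dg : derivable (g - cst (g a)) w 1.
  by apply: derivableB gd _; exact: derivable_cst.
have d1 := derivableM dg (derivableM dK dK).
have d3 : derivable (L \*: (fun y : C R => ((@id (C R) - cst a) y)^-1 : C R)) w 1.
  exact: derivableZ dK.
have d4 := derivableB d1 d3.
exact: d4.
Qed.

(** Of the sixteen squares of side [u], the central four are reassembled by [bsumS] into one square
    of side 2u; the other twelve form a ring around it. *)
Lemma bsum_annulus n (h : R[i] -> R[i]) x y u :
  bsum n.+2 h x y (4 * u) = bsum n.+1 h (x + u) (y + u) (2 * u) +
  (bsum n h x y u + bsum n h (x + u) y u + bsum n h (x + 2 * u) y u +
   bsum n h (x + 3 * u) y u + bsum n h x (y + u) u + bsum n h x (y + 2 * u) u +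
   bsum n h (x + 3 * u) (y + u) u + bsum n h (x + 3 * u) (y + 2 * u) u +
   bsum n h x (y + 3 * u) u + bsum n h (x + u) (y + 3 * u) u +
   bsum n h (x + 2 * u) (y + 3 * u) u + bsum n h (x + 3 * u) (y + 3 * u) u).
Proof.
rewrite !bsumS.
have E1 : 4 * u / 2 = 2 * u by lra.
have E2 : 2 * u / 2 = u by lra.
have E3 (t : R) : t + 2 * u + u = t + 3 * u by lra.
have E4 (t : R) : t + u + u = t + 2 * u by lra.
rewrite !E1 !E2 !E3 !E4; ring.
Qed.

(** A crude replacement for the value 2 pi i, valid at every level [n]: across opposite edges the
    kernel contributes 2s / (t^2 + s^2) >= 1 / s to the imaginary part, on two pairs of edges of
    length 2s. *)
Lemma cauchy_kernel_ge n (a1 a2 s : R) : 0 < s ->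
  4 <= Im (bsum n (fun w => (w - (a1 +i* a2))^-1) (a1 - s) (a2 - s) (2 * s)).
Proof.
move=> s0.
have key t : - s <= t <= s -> s^-1 <= s / (t ^+ 2 + s ^+ 2) + s / (t ^+ 2 + s ^+ 2).
  move=> ts; have p : 0 < t ^+ 2 + s ^+ 2 by rewrite ltr_wpDl ?sqr_ge0 ?exprn_gt0.
  rewrite -mulrDl ler_pdivlMr // ler_pdivrMl //.
  have : 0 <= (s - t) * (s + t) by apply: mulr_ge0; lra.
  rewrite !expr2; lra.
rewrite /bsum -rsumZ (raddfD (@complex.Im R : Rcomplex R -> R)).
have -> : 4 = s^-1 * (2 * s) + s^-1 * (2 * s) :> R by field; rewrite gt_eqF.
apply: lerD; apply: rsum_Im_ge => [|t ht] /=; try lra.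
  have hs : - s <= t - a1 <= s by lra.
  apply: le_trans (key _ hs) _.
  have -> : a2 - s + 2 * s - a2 = s by lra.
  have -> : a2 - s - a2 = - s by lra.
  by rewrite sqrrN mulNr opprK.
have hs : - s <= t - a2 <= s by lra.
apply: le_trans (key _ hs) _.
have -> : a1 - s + 2 * s - a1 = s by lra.
have -> : a1 - s - a1 = - s by lra.
by rewrite sqrrN [s ^+ 2 + _]addrC mul0r mul1r add0r mulNr opprK.
Qed.

(** With H = G - L K, the sums of H are eventually at most 1 in modulus, those of K at least 4, and
    those of G at most 16 M / s; comparing them bounds L. *)
Lemma cauchy_estimate g (a L : R[i]) s M : 0 < s ->
  (forall w, normc (w - a) <= 2 * s -> derivable g w 1) ->
  (forall w, normc (w - a) <= 2 * s -> normc (g w) <= M) ->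
  cderiv g a L -> normc L <= 4 * M / s + 1.
Proof.
move=> s0 gd gM gL; case: a => a1 a2 in gd gM gL *.
set a : R[i] := a1 +i* a2 in gd gM gL *.
pose G (w : R[i]) := (g w - g a) * ((w - a)^-1 * (w - a)^-1).
pose K (w : R[i]) := (w - a)^-1.
pose H (w : R[i]) := G w - L * K w.
(* This holds at [w = a] too, where both sides are 0 because the inverse of 0 is 0. *)
have HE w : H w = (g w - g a - L * (w - a)) / (w - a) ^+ 2.
  rewrite /H /G /K; have [->|wa] := eqVneq w a.
    by rewrite !subrr expr0n /= invr0 !mulr0 subr0.
  by field; rewrite subr_eq0.
have near_a (u v r : R) : a1 - r <= u <= a1 + r -> a2 - r <= v <= a2 + r ->
    normc ((u +i* v) - a) <= 2 * r.
  move=> hu hv; apply: le_trans (normc_le_ReIm _) _ => /=.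
  have : `|u - a1| <= r by rewrite ler_norml; lra.
  have : `|v - a2| <= r by rewrite ler_norml; lra.
  lra.
have Hd w : normc (w - a) <= 2 * s -> w != a -> exists L', cderiv H w L'.
  move=> ws wa; apply: derivable_cderiv.
  exact: derivable_dquot2 L wa (gd w ws).
pose T c (r : R) := forall e, 0 < e -> \forall n \near \oo,
  normc (bsum n H (a1 - r) (a2 - r) (2 * r)) <= c + e.
(* Doubling the square adds a ring of twelve squares that avoid [a], to which [goursat] applies. *)
have Tstep c r : 0 < r -> r <= s -> T c (r / 2) -> T c r.
  move=> r0 rs Tc e e0; set u := r / 2 in Tc.
  have u0 : 0 < u by rewrite divr_gt0.
  have ru : r = 2 * u by rewrite /u; field.
  have e2 : 0 < e / 2 by rewrite divr_gt0.
  (* The twelve ring squares share e / 2; the other half goes to the inner square. *)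
  have e24 : 0 < e / 24 by rewrite divr_gt0.
  have outer x y : a1 - r <= x -> x + u <= a1 + r -> a2 - r <= y ->
      y + u <= a2 + r ->
      [|| x + u < a1, a1 < x, y + u < a2 | a2 < y] ->
      \forall n \near \oo, normc (bsum n H x y u) <= e / 24.
    move=> h1 h2 h3 h4 h5; apply: goursat => // u1 v1 hu hv; apply: Hd.
      by apply: le_trans (near_a _ _ r _ _) _; lra.
    by apply/eqP => -[hu1 hv1]; move: h5; rewrite -hu1 -hv1 => /or4P[] ?; lra.
  have [N1 _ HN1] := Tc _ e2.
  suff [N _ HN] : \forall n \near \oo,
      normc (bsum n.+2 H (a1 - r) (a2 - r) (2 * r)) <= c + e.
    by exists N.+2 => // -[|[|n]] //=; rewrite !ltnS; exact: HN.
  have E1 : 2 * r = 4 * u by rewrite ru; ring.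
  have E2 (t : R) : t - u = t - r + u by rewrite ru; ring.
  near=> n; rewrite E1 bsum_annulus; set B := bsum n.+1 _ _ _ _.
  have hB : normc B <= c + e / 2.
    rewrite /B -!E2; apply: HN1 => /=.
    by apply: leq_trans (leqnSn n); near: n; exists N1.
  have big (f : R[i]) (S : R[i]) m : normc S <= m -> normc f <= e / 24 ->
      normc (S + f) <= m + e / 24.
    by move=> h1 h2; apply: le_trans (normc_triangle _ _) _; rewrite lerD.
  apply: le_trans (normc_triangle _ _) _.
  have -> : c + e = (c + e / 2) + (e / 24 + e / 24 + e / 24 + e / 24 + e / 24 +
    e / 24 + e / 24 + e / 24 + e / 24 + e / 24 + e / 24 + e / 24) by field.
  apply: lerD => //.
  repeat (apply: (big)); near: n; apply: outer; clear -u0 ru; rewrite ru; try lra;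
    apply/or4P; first [by constructor 1; lra | by constructor 2; lra
                      | by constructor 3; lra | by constructor 4; lra].
have Tpow c j r : 0 < r -> r <= s -> T c (r * (1 / 2 ^+ j)) -> T c r.
  elim: j r => [|j ih] r r0 rs; first by rewrite expr0 divr1 mulr1.
  rewrite exprS => Tj; apply: Tstep => //; apply: ih; [lra|lra|].
  have n0 : (2 ^+ j : R) != 0 by rewrite expf_neq0.
  by rewrite (_ : r / 2 * _ = r * (1 / (2 * 2 ^+ j))) //; field.
(* With tolerance 1/16, H is at most 1 / (16 r) on the edges of a small square, and the perimeter 8r
   yields 1/2. *)
have [d d0 hd] := gL (1 / 16) ltac:(lra).
have Tsmall r : 0 < r -> r < d / 2 -> T (1 / 2) r.
  move=> r0 rd e e0; apply: nearW => n.
  apply: (@le_trans _ _ (4 * ((1 / 16) / r) * (2 * r))); last first.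
    have -> : 4 * (1 / 16 / r) * (2 * r) = 1 / 2 by field; rewrite gt_eqF.
    by rewrite lerDl ltW.
  apply: bsum_le => [|u v hu hv bd]; first lra.
  set w : R[i] := u +i* v.
  have w2 : normc (w - a) <= 2 * r by apply: near_a; lra.
  have w1 : r <= normc (w - a).
    case/or4P: bd => /eqP bd.
    - apply: le_trans (normc_Re _); rewrite /= bd ler_normr; apply/orP; right; lra.
    - apply: le_trans (normc_Re _); rewrite /= bd ler_normr; apply/orP; left; lra.
    - apply: le_trans (normc_Im _); rewrite /= bd ler_normr; apply/orP; right; lra.
    - apply: le_trans (normc_Im _); rewrite /= bd ler_normr; apply/orP; left; lra.
  have w0 : 0 < normc (w - a) by lra.
  rewrite HE normcM normcV normcX ler_pdivrMr ?exprn_gt0 //.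
  apply: le_trans (hd _ _) _; first lra.
  rewrite expr2 mulrA ler_wpM2r ?(ltW w0) //.
  by rewrite [leRHS]mulrAC ler_pdivlMr //; lra.
have Ts : T (1 / 2) s.
  have ds0 : 0 < d / 2 / s by rewrite !divr_gt0.
  have [N _ /(_ N (leqnn N)) /=] := near_infty_natSinv_expn_lt (PosNum ds0).
  rewrite ltr_pdivlMr // mulrC => sN; apply: (Tpow _ N) => //; apply: Tsmall => //.
  by rewrite mulr_gt0 // divr_gt0 // exprn_gt0.
(* A single level [n] suffices, since the bounds for K and G hold at every level. *)
have [n _ /(_ n (leqnn n)) /= Hn] := Ts (1 / 2) ltac:(lra).
have Kn : 4 <= normc (bsum n K (a1 - s) (a2 - s) (2 * s)).
  apply: le_trans (normc_Im _); apply: le_trans (ler_norm _).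
  exact: cauchy_kernel_ge.
have Gn : normc (bsum n G (a1 - s) (a2 - s) (2 * s)) <= 4 * (2 * M / s ^+ 2) * (2 * s).
  apply: bsum_le => [|u v hu hv bd]; first lra.
  set w : R[i] := u +i* v.
  have w2 : normc (w - a) <= 2 * s by apply: near_a; lra.
  have w1 : s <= normc (w - a).
    case/or4P: bd => /eqP bd.
    - apply: le_trans (normc_Re _); rewrite /= bd ler_normr; apply/orP; right; lra.
    - apply: le_trans (normc_Re _); rewrite /= bd ler_normr; apply/orP; left; lra.
    - apply: le_trans (normc_Im _); rewrite /= bd ler_normr; apply/orP; right; lra.
    - apply: le_trans (normc_Im _); rewrite /= bd ler_normr; apply/orP; left; lra.
  rewrite /G -invfM -expr2 normcM normcV normcX; apply: ler_pM.
  - exact: normc_ge0.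
  - by rewrite invr_ge0 exprn_ge0 // normc_ge0.
  - apply: le_trans (normc_triangle _ _) _; rewrite normc_opp.
    have := gM w w2; have := gM a; rewrite subrr normc0; lra.
  - by rewrite lef_pV2 ?posrE ?exprn_gt0 // ?lerXn2r ?nnegrE; lra.
have LK : L * bsum n K (a1 - s) (a2 - s) (2 * s) =
    bsum n G (a1 - s) (a2 - s) (2 * s) - bsum n H (a1 - s) (a2 - s) (2 * s).
  by rewrite /H bsumB bsumZ; ring.
have : normc L * 4 <= 16 * M / s + 1.
  apply: le_trans (ler_wpM2l (normc_ge0 L) Kn) _.
  rewrite -normcM LK; apply: le_trans (normc_triangle _ _) _; rewrite normc_opp.
  have -> : 16 * M / s = 4 * (2 * M / s ^+ 2) * (2 * s) by field; rewrite gt_eqF.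
  rewrite lerD //; lra.
have -> : 16 * M / s = 4 * (4 * M / s) by field; rewrite gt_eqF.
lra.
Unshelve. all: by end_near.
Qed.

End CauchyEstimate.

(** * Holomorphic functions are locally Lipschitz *)

Section LocalLipschitz.
Variable R : realType.
Implicit Types (r s t u x M e : R) (g h : C R -> C R) (z w L : R[i]).

(** Bisection of the parameter interval of the segment. The extra 1 in [M + 1] pays for the
    first-order remainder, taken with tolerance 1. *)
Lemma mean_value (h : R[i] -> R[i]) z w M :
  (forall t, 0 <= t <= 1 ->
     exists2 L, cderiv h (z + t%:C * (w - z)) L & normc L <= M) ->
  normc (h w - h z) <= (M + 1) * normc (w - z).
Proof.
move=> hd; pose zeta t := z + t%:C * (w - z); pose D := normc (w - z).
have D0 : 0 <= D by exact: normc_ge0.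
suff : normc (h (zeta (0 + 1)) - h (zeta 0)) <= (M + 1) * 1 * D.
  by rewrite mulr1 /zeta add0r mul1r mul0r addr0 subrKC.
pose P x s := normc (h (zeta (x + s)) - h (zeta x)) <= (M + 1) * s * D.
apply: (@interval_bisection R P) => //.
  rewrite /P => x s s0.
  have -> : x + s / 2 + s / 2 = x + s by field.
  have := normc_sub_triangle (h (zeta (x + s))) (h (zeta (x + s / 2))) (h (zeta x)).
  have -> : (M + 1) * s * D = (M + 1) * (s / 2) * D + (M + 1) * (s / 2) * D by field.
  lra.
move=> u hu; have [L hL LM] : exists2 L, cderiv h (zeta u) L & normc L <= M.
  by apply: hd; lra.
have [d d0 hLd] := hL 1 ltac:(lra).
(* The divisor is [D + 1] because [D] vanishes when the endpoints coincide. *)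
have loc t : `|t - u| < d / (D + 1) ->
    normc (h (zeta t) - h (zeta u)) <= (M + 1) * `|t - u| * D.
  have e : normc (zeta t - zeta u) = `|t - u| * D.
    have -> : zeta t - zeta u = (t - u)%:C * (w - z).
      by rewrite /zeta rmorphB /=; ring.
    by rewrite normcM normc_real.
  rewrite ltr_pdivlMr; last lra.
  move=> tu; have /hLd : normc (zeta t - zeta u) < d.
    rewrite e; apply: le_lt_trans tu; rewrite ler_wpM2l //; lra.
  have := normc_subl (h (zeta t) - h (zeta u)) (L * (zeta t - zeta u)).
  rewrite normcM e.
  have : normc L * (`|t - u| * D) <= M * (`|t - u| * D).
    by rewrite ler_wpM2r // mulr_ge0.
  lra.
exists (d / (D + 1)); first by rewrite divr_gt0 //; lra.
move=> x s sd h1 h2 h3; rewrite /P.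
have := normc_sub_triangle (h (zeta (x + s))) (h (zeta u)) (h (zeta x)).
rewrite [normc (h (zeta u) - _)]normc_distC.
have a1 : `|x + s - u| = x + s - u by rewrite ger0_norm; lra.
have a2 : `|x - u| = u - x by rewrite ler0_norm; lra.
have := loc (x + s); rewrite a1 => /(_ ltac:(lra)).
have := loc x; rewrite a2 => /(_ ltac:(lra)).
have -> : (M + 1) * s * D = (M + 1) * (u - x) * D + (M + 1) * (x + s - u) * D by ring.
lra.
Qed.

Lemma cderiv_continuous (h : R[i] -> R[i]) z L : cderiv h z L -> forall e, 0 < e ->
  exists2 d, 0 < d & forall w, normc (w - z) < d -> normc (h w - h z) <= e.
Proof.
move=> hL e e0; have [d d0 hd] := hL 1 ltac:(lra).
have L0 := normc_ge0 L.
exists (Order.min d (e / (normc L + 1))) => [|w].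
  by rewrite lt_min d0 divr_gt0 //; lra.
rewrite lt_min => /andP[/hd H]; rewrite ltr_pdivlMr; last lra.
have := normc_subl (h w - h z) (L * (w - z)); rewrite normcM; lra.
Qed.

Lemma open_normc (V : set (C R)) (p : C R) : open V -> V p ->
  exists2 d, 0 < d & forall w : C R, normc (w - p) < d -> V w.
Proof.
move=> oV Vp; have /nbhs_ballP[d /= d0 hd] : nbhs p V by exact: open_nbhs_nbhs.
have dR : d = (normc d)%:C by rewrite -[LHS]ger0_norm // ltW.
have d0' : 0 < normc d by move: d0; rewrite {1}dR -[0]/(0%:C) ltcR.
exists (normc d) => // w wd; apply: hd; rewrite -ball_normE /=.
by rewrite {1}dR -[`|_|]/((normc (p - w))%:C) ltcR normc_distC.
Qed.

(** Continuity at [p] bounds [g] nearby, [cauchy_estimate] turns this into a uniform bound on the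
    derivatives, and [mean_value] integrates it along segments. *)
Lemma holomorphic_locally_lipschitz g (V : set (C R)) (p : C R) :
  open V -> V p -> holomorphic_on V g ->
  exists r M, [/\ 0 < r, 0 < M, (forall w : C R, normc (w - p) < r -> V w) &
    forall z w, normc (z - p) < r -> normc (w - p) < r ->
      normc (g z - g w) <= M * normc (z - w)].
Proof.
move=> oV Vp hg; have [r0 r00 hr0] := open_normc oV Vp.
have [Lp /cderiv_continuous/(_ 1 ltac:(lra))[d d0 hd]] := derivable_cderiv (hg p Vp).
pose r := Order.min r0 d.
have r_gt0 : 0 < r by rewrite lt_min r00.
have rV w : normc (w - p) < r -> V w /\ normc (g w) <= normc (g p) + 1.
  rewrite lt_min => /andP[/hr0 Vw /hd H]; split=> //.
  by have := normc_subl (g w) (g p); lra.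
have gp0 := normc_ge0 (g p).
(* The estimate is used with s = r / 8: points within r / 4 of [a], itself within r / 2 of [p], stay
   where [g] is bounded. *)
pose M := 4 * (normc (g p) + 1) / (r / 8) + 1.
have M0 : 0 < M by rewrite ltr_wpDl // divr_ge0 //; lra.
have est a L : normc (a - p) < r / 2 -> cderiv g a L -> normc L <= M.
  move=> ap; apply: cauchy_estimate; first lra.
    move=> w wa; apply: hg; apply: (rV w _).1.
    by have := normc_sub_triangle w a p; lra.
  move=> w wa; apply: (rV w _).2.
  by have := normc_sub_triangle w a p; lra.
exists (r / 2), (M + 1); split; [lra|lra| |].
  by move=> w wp; apply: (rV w _).1; lra.
move=> w z wp zp; apply: mean_value => t t01.
have seg : normc (z + t%:C * (w - z) - p) < r / 2.
  have -> : z + t%:C * (w - z) - p = (1 - t)%:C * (z - p) + t%:C * (w - p).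
    by rewrite rmorphB /=; ring.
  apply: le_lt_trans (normc_triangle _ _) _; rewrite !normcM !normc_real.
  rewrite (ger0_norm (_ : 0 <= 1 - t)); last lra.
  rewrite (ger0_norm (_ : 0 <= t)); last lra.
  (* Whichever weight is at least 1/2 is nonzero and supplies the strict inequality. *)
  have [t0|t0] := leP (1 / 2) t.
    have : (1 - t) * normc (z - p) <= (1 - t) * (r / 2) by rewrite ler_wpM2l; lra.
    have : t * normc (w - p) < t * (r / 2) by rewrite ltr_pM2l; lra.
    lra.
  have : (1 - t) * normc (z - p) < (1 - t) * (r / 2) by rewrite ltr_pM2l; lra.
  have : t * normc (w - p) <= t * (r / 2) by rewrite ler_wpM2l; lra.
  lra.
have Vs : V (z + t%:C * (w - z)) by apply: (rV _ _).1; lra.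
have [L hL] := derivable_cderiv (hg _ Vs).
by exists L => //; exact: est seg hL.
Qed.

End LocalLipschitz.

(** * Level and sublevel sets near one zero *)

Section LevelNearZero.
Variable R : realType.
Implicit Types (r s t u x M K e : R) (z w a : R[i]).

(** Splits a displacement into an angular part at radius |z| and a radial part along the direction
    of [w]. *)
Lemma complex_decomp z w :
  z - w = (normc z)%:C * (z / (normc z)%:C - w / (normc w)%:C) +
          (normc z - normc w)%:C * (w / (normc w)%:C).
Proof.
have polar (v : R[i]) : (normc v)%:C * (v / (normc v)%:C) = v.
  have [->|v0] := eqVneq v 0; first by rewrite mul0r mulr0.
  rewrite mulrC divfK //; apply/eqP => -[] /eqP.
  by rewrite normc_eq0 (negPf v0).
rewrite rmorphB /= mulrBl mulrBr !polar; ring.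
Qed.

Lemma normc_dir z : z != 0 -> normc (z / (normc z)%:C) = 1.
Proof.
move=> z0; rewrite normcM normcV normc_real ger0_norm ?normc_ge0 //.
by rewrite divff // normc_eq0.
Qed.

Lemma level_near_zero (f : C R -> C R) a (k : nat) : zero_of_multiplicity f a k ->
  exists r K, [/\ 0 < r, 0 < K,
    (forall e z, 0 < e -> normc (z - a) < r -> normc (f z) <= e ->
       normc (z - a) <= K * e `^ (1 / k%:R)) &
    (forall e z w, 0 < e -> normc (z - a) < r -> normc (w - a) < r ->
       normc (f z) = e -> normc (f w) = e ->
       normc (z - w) <= 2 * (K * e `^ (1 / k%:R)) *
         normc ((z - a) / (normc (z - a))%:C - (w - a) / (normc (w - a))%:C))].
Proof.
move=> [k0 [V [g [oV Va hg ga fE]]]].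
have [r1 [M [r10 M0 rV lip]]] := holomorphic_locally_lipschitz oV Va hg.
pose m0 := normc (g a) / 2.
have m00 : 0 < m0 by rewrite divr_gt0 // normc_gt0.
(* This radius makes M |z - a| at most m0 / 2, so |g| stays above m0, half of |g(a)|. *)
pose r := Order.min r1 (m0 / (2 * M)).
have r0 : 0 < r by rewrite lt_min r10 divr_gt0 // mulr_gt0.
have near z : normc (z - a) < r -> [/\ normc (z - a) < r1,
    M * normc (z - a) <= m0 / 2, m0 <= normc (g z) &
    normc (f z) = normc (z - a) ^+ k * normc (g z)].
  rewrite lt_min => /andP[zr1]; rewrite ltr_pdivlMr ?mulr_gt0 // => zr2.
  split=> //; [lra| |by rewrite fE ?normcM ?normcX //; exact: rV].
  have : normc (g a) - normc (g z) <= M * normc (z - a).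
    apply: le_trans (normc_subl _ _) _; rewrite normc_distC.
    by apply: lip; rewrite // subrr normc0.
  have -> : normc (g a) = 2 * m0 by rewrite /m0; field.
  lra.
pose K := m0^-1 `^ (1 / k%:R).
(* The constant [K] arises from |z - a|^k m0 <= e by taking k-th roots. *)
have k1 : (0 : R) <= 1 / k%:R by rewrite divr_ge0.
have bound e z : 0 < e -> normc (z - a) < r -> normc (f z) <= e ->
    normc (z - a) <= K * e `^ (1 / k%:R).
  move=> e0 /near[_ _ gz fz]; rewrite fz => fe.
  have za := normc_ge0 (z - a).
  rewrite -powRM ?invr_ge0 ?(ltW m00) ?(ltW e0) //.
  have -> : normc (z - a) = (normc (z - a) ^+ k) `^ (1 / k%:R).
    by rewrite -powR_mulrn // -powRrM mulrC divfK ?powRr1 // pnatr_eq0 -lt0n.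
  apply: ge0_ler_powR => //; rewrite ?nnegrE ?exprn_ge0 //.
    by rewrite mulr_ge0 ?invr_ge0 ?(ltW m00) ?(ltW e0).
  rewrite ler_pdivlMl // mulrC; apply: le_trans fe.
  by rewrite ler_wpM2l // exprn_ge0.
exists r, K; split=> //; first by rewrite powR_gt0 // invr_gt0.
move=> e z w e0 zr wr fz fw.
wlog zw : z w zr wr fz fw / normc (z - a) <= normc (w - a) => [wl|].
  have [zw|/ltW wz] := leP (normc (z - a)) (normc (w - a)); first exact: wl.
  by rewrite normc_distC [X in _ <= _ * X]normc_distC; exact: wl.
have bz := bound e z e0 zr; rewrite fz lexx in bz; move: bz => /(_ isT) bz.
have [zr1 zM gz fzE] := near z zr; have [wr1 _ gw fwE] := near w wr.
rewrite fz in fzE; rewrite fw in fwE.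
have lz := lip z w zr1 wr1; have lz2 := normc_subl (g z) (g w).
have diff0 : z - w = (z - a) - (w - a) by ring.
have A0 : 0 <= normc (z - a) by exact: normc_ge0.
have w0 : w - a != 0.
  apply/eqP => w0; move: fwE; rewrite w0 normc0 expr0n eqn0Ngt k0 mul0r => e00.
  by rewrite e00 ltxx in e0.
have B0 : 0 < normc (w - a) by rewrite normc_gt0.
have dec := complex_decomp (z - a) (w - a); rewrite -diff0 in dec.
have nv := normc_dir w0.
set A := normc (z - a) in zw bz zM fzE A0 dec *.
set B := normc (w - a) in zw fwE B0 dec nv *.
set D := normc (z - w) in lz *.
have D0 : 0 <= D by exact: normc_ge0.
(* Writing the multiplicity as k + 1, one has (B - A) B^k <= B^(k+1) - A^(k+1); equality of |f| at
   both points and the Lipschitz bound give (B - A) B^k m0 <= A B^k M D, and M A <= m0 / 2. *)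
have BA : B - A <= D / 2.
  case: k k0 fzE fwE {fE near K k1 bound bz} => // k _ fzE fwE.
  have Bk : 0 < B ^+ k by rewrite exprn_gt0.
  have AB : A ^+ k <= B ^+ k by rewrite lerXn2r ?nnegrE // ltW.
  have Ak : A ^+ k.+1 <= A * B ^+ k by rewrite exprS ler_wpM2l.
  have h1 : (B - A) * B ^+ k * m0 <= (B ^+ k.+1 - A ^+ k.+1) * normc (g w).
    apply: ler_pM => //; [|exact: ltW|by rewrite mulrBl -exprS; lra].
    by rewrite mulr_ge0 ?(ltW Bk) // subr_ge0.
  have h2 : (B ^+ k.+1 - A ^+ k.+1) * normc (g w) =
      A ^+ k.+1 * (normc (g z) - normc (g w)).
    by rewrite mulrBl mulrBr -fzE -fwE.
  have h3 : A ^+ k.+1 * (normc (g z) - normc (g w)) <= A * B ^+ k * (M * D).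
    apply: (@le_trans _ _ (A ^+ k.+1 * (M * D))).
      by rewrite ler_wpM2l ?exprn_ge0 //; lra.
    by rewrite ler_wpM2r // mulr_ge0 // ltW.
  have h4 : (M * A) * D <= (m0 / 2) * D by rewrite ler_wpM2r.
  have : (B - A) * m0 * B ^+ k <= (D / 2) * m0 * B ^+ k.
    apply: (@le_trans _ _ (A * B ^+ k * (M * D))); first by rewrite mulrAC; lra.
    have -> : A * B ^+ k * (M * D) = (M * A) * D * B ^+ k by ring.
    by rewrite ler_wpM2r ?(ltW Bk) //; lra.
  by rewrite !ler_pM2r.
set d := normc (_ - _) in dec *.
(* The radial part is at most D / 2 and is absorbed on the left, whence the factor 2 in the
   conclusion. *)
have Dd : D <= A * d + (B - A).
  rewrite /D dec; apply: le_trans (normc_triangle _ _) _.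
  rewrite (normcM A%:C) (normcM (A - B)%:C) !normc_real (ger0_norm A0) nv mulr1.
  rewrite ler0_norm; last lra.
  by rewrite opprB.
have d0 : 0 <= d by exact: normc_ge0.
have : A * d <= K * e `^ (1 / k%:R) * d by rewrite ler_wpM2r.
lra.
Qed.

End LevelNearZero.

(** * Partition of the unit circle into small cells *)

Section DirectionCells.
Variable R : realType.
Implicit Types (x y : R) (u v : R[i]).

(** Slots of width 2 / N on [-1, 1]; the endpoint 1 has index [N], hence [N.+1] slots. *)
Let slot N x : 'I_N.+1 := inord (Num.trunc ((x + 1) / 2 * N%:R)).

Lemma slot_close N x y : (0 < N)%N -> -1 <= x <= 1 -> -1 <= y <= 1 ->
  slot N x = slot N y -> `|x - y| <= 2 / N%:R.
Proof.
move=> N0 hx hy; have N0' : (0 : R) < N%:R by rewrite ltr0n.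
have pos (z : R) : -1 <= z <= 1 -> 0 <= (z + 1) / 2 * N%:R.
  by move=> hz; rewrite mulr_ge0 //; lra.
have small (z : R) : -1 <= z <= 1 -> (Num.trunc ((z + 1) / 2 * N%:R) < N.+1)%N.
  move=> hz; have /andP[h _] := truncn_itv (pos z hz).
  rewrite ltnS -(ler_nat R); apply: le_trans h _.
  by rewrite ler_piMl ?(ltW N0') //; lra.
move=> /(congr1 val); rewrite /= !inordK ?small // => e.
have /andP[x1 x2] := truncn_itv (pos x hx).
have /andP[y1 y2] := truncn_itv (pos y hy).
rewrite e in x1 x2; move: (Num.trunc _) x1 x2 y1 y2 => n x1 x2 y1 y2.
have n1 : n.+1%:R = n%:R + 1 :> R by rewrite natr1.
rewrite n1 in x2 y2.
have d1 : `|(x + 1) / 2 * N%:R - (y + 1) / 2 * N%:R| <= 1 by rewrite ler_norml; lra.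
have e2 : (x + 1) / 2 * N%:R - (y + 1) / 2 * N%:R = (x - y) * (N%:R / 2) by field.
rewrite e2 normrM (ger0_norm (_ : 0 <= N%:R / 2)) in d1; last lra.
by rewrite ler_pdivlMr //; lra.
Qed.

(* On a quarter of the unit circle the coordinate of smaller modulus is a
   parameter, and the other coordinate is a 1-Lipschitz function of it. *)
Definition dir_cell N u : bool * bool * 'I_N.+1 :=
  if `|Re u| <= `|Im u| then (true, 0 <= Im u, slot N (Re u))
  else (false, 0 <= Re u, slot N (Im u)).

Lemma dir_cell_close N u v : (0 < N)%N -> normc u = 1 -> normc v = 1 ->
  dir_cell N u = dir_cell N v -> normc (u - v) <= 4 / N%:R.
Proof.
have circ (w : R[i]) : normc w = 1 ->
    [/\ Re w ^+ 2 + Im w ^+ 2 = 1, -1 <= Re w <= 1 & -1 <= Im w <= 1].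
  move=> w1; have := normc_Re w; have := normc_Im w; rewrite w1 !ler_norml.
  move=> -> ->; split=> //; case: w w1 => p q /= /(congr1 (fun x => x ^+ 2)).
  by rewrite sqr_sqrtr ?addr_ge0 ?sqr_ge0 // expr1n.
(* On the circle |y - y'| |y + y'| = |x - x'| |x + x'|, and |x + x'| <= |y| + |y'| = |y + y'| when
   the signs agree. *)
have arc (x y x' y' : R) : x ^+ 2 + y ^+ 2 = 1 -> x' ^+ 2 + y' ^+ 2 = 1 ->
    `|x| <= `|y| -> `|x'| <= `|y'| -> (0 <= y) = (0 <= y') -> `|y - y'| <= `|x - x'|.
  move=> h h' xy xy' sg.
  have yy : `|y + y'| = `|y| + `|y'|.
    have [y0|y0] := leP 0 y.
      have y0' : 0 <= y' by rewrite -sg.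
      by rewrite !ger0_norm // addr_ge0.
    have y0' : y' < 0 by rewrite ltNge -sg -ltNge.
    rewrite !ltr0_norm //; [lra|lra].
  have y1 : 0 < `|y|.
    rewrite normr_gt0; apply/eqP => y0; move: h xy; rewrite y0 normr0 normr_le0.
    move=> h /eqP x0; move: h; rewrite x0 expr0n /= addr0 => /esym/eqP.
    by rewrite oner_eq0.
  have pos : 0 < `|y + y'| by rewrite yy ltr_pwDl.
  rewrite -(ler_pM2r pos) -normrM.
  have -> : (y - y') * (y + y') = - ((x - x') * (x + x')).
    have : (y - y') * (y + y') + (x - x') * (x + x') = 0.
      have -> : (y - y') * (y + y') + (x - x') * (x + x') =
        (x ^+ 2 + y ^+ 2) - (x' ^+ 2 + y' ^+ 2) by ring.
      by rewrite h h' subrr.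
    lra.
  rewrite normrN normrM ler_wpM2l // yy.
  by apply: le_trans (ler_normD _ _) _; rewrite lerD.
move=> N0 /circ[u1 ux uy] /circ[v1 vx vy].
have four : 4 / N%:R = 2 / N%:R + 2 / N%:R :> R by rewrite -mulrDl; congr (_ / _); ring.
rewrite /dir_cell; case: ifP => hu; case: ifP => hv // -[sg sl].
  have := slot_close N0 ux vx sl; have := arc _ _ _ _ u1 v1 hu hv sg => h1 h2.
  apply: le_trans (normc_le_ReIm _) _; rewrite four.
  move: h1 h2; clear; case: u => a b; case: v => a' b' /=; lra.
have hu' : `|Im u| <= `|Re u| by rewrite ltW // ltNge hu.
have hv' : `|Im v| <= `|Re v| by rewrite ltW // ltNge hv.
rewrite addrC in u1; rewrite addrC in v1.
have := slot_close N0 uy vy sl; have := arc _ _ _ _ u1 v1 hu' hv' sg => h1 h2.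
apply: le_trans (normc_le_ReIm _) _; rewrite four.
move: h1 h2; clear; case: u => a b; case: v => a' b' /=; lra.
Qed.

End DirectionCells.

(** * Upper bounds for Hausdorff measure and area from finite covers *)

Section MeasureBounds.
Variable R : realType.

Lemma diam_le (A : set (C R)) (D : R) : 0 <= D ->
  (forall z w, A z -> A w -> normc (z - w) <= D) -> (diam A <= D%:E)%E.
Proof.
move=> D0 AD; apply: ge_ereal_sup => _ [->|[[z w] /= [Az Aw] <-]].
  by rewrite lee_fin.
by rewrite lee_fin AD.
Qed.

Lemma diam_ge0 (A : set (C R)) : (0 <= diam A)%E.
Proof. by apply: ereal_sup_ubound; left. Qed.

Lemma hausdorff1_le (A : set (C R)) (B : R) :
  (forall d, 0 < d -> exists (T : finType) (F : T -> set (C R)) (D : T -> R),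
    [/\ forall z, A z -> exists t, F t z, forall t, (diam (F t) <= (D t)%:E)%E,
        forall t, D t <= d & \sum_t D t <= B]) ->
  (hausdorff1 A <= B%:E)%E.
Proof.
move=> cov; apply: ge_ereal_sup => _ [d d0 <-].
have [T [F [D [AF FD Dd DB]]]] := cov d d0.
(* The finite cover is padded with empty sets, of diameter 0, to a sequence. *)
pose G n := nth set0 [seq F t | t <- enum T] n.
have sG : size [seq F t | t <- enum T] = #|T| by rewrite size_map -cardE.
have diam0 : diam (set0 : set (C R)) = 0%E.
  by apply/eqP; rewrite eq_le diam_ge0 andbT; apply: diam_le.
apply: (@le_trans _ _ (\sum_(0 <= n <oo) diam (G n))%E).
  apply: ereal_inf_lbound; exists G => //; split.
    move=> z /AF[t Ftz]; exists (enum_rank t) => //.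
    by rewrite /G (nth_map t) ?nth_enum_rank // -cardE.
  move=> n; have [nT|nT] := ltnP n #|T|; last first.
    by rewrite /G nth_default ?sG // diam0 lee_fin ltW.
  have t0 : T by exact: (enum_val (Ordinal nT)).
  rewrite /G (nth_map t0) -?cardE //.
  by apply: le_trans (FD _) _; rewrite lee_fin.
rewrite (nneseries_split 0 #|T|) ?add0n; last by move=> *; exact: diam_ge0.
rewrite eseries0 ?adde0; last first.
  by move=> n nT _; rewrite /G nth_default ?sG.
rewrite -sG -(big_nth set0 xpredT (fun S => diam S)) big_map big_enum /=.
apply: (@le_trans _ _ (\sum_t (D t)%:E)%E); first exact: lee_sum.
by rewrite sumEFin lee_fin.
Qed.

(** Each vertical slice of [A] is covered by the slices of the squares; integrating their lengths
    gives the sum of the areas. *)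
Lemma area_le (T : finType) (A : set (C R)) (c : T -> C R) (h : T -> R) :
  (forall t, 0 <= h t) ->
  (forall z, A z -> exists t, `|Re z - Re (c t)| <= h t /\ `|Im z - Im (c t)| <= h t) ->
  (area A <= (\sum_t 4 * h t ^+ 2)%:E)%E.
Proof.
move=> h0 Ah.
pose I (x r : R) : set (measurableTypeR R) := [set` `[x - r, x + r]].
have mI x r : measurable (I x r) by exact: measurable_itv.
have lI x r : 0 <= r -> lebesgue_measure (I x r) = (2 * r)%:E.
  move=> r0; rewrite /I lebesgue_measure_itv /= lte_fin; case: ltP => hr.
    by rewrite -EFinB; congr (_%:E); ring.
  by congr (_%:E); lra.
rewrite /area /product_measure1 /=.
apply: (@le_trans _ _ (\int[lebesgue_measure]_x
   (\sum_t (2 * h t)%:E * (\1_(I (Re (c t)) (h t)) x)%:E))%E).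
  (* As suprema over simple functions below the integrand, the integrals compare pointwise without
     measurability of the slice function. *)
  rewrite !ge0_integralTE; last 2 first.
  - by move=> x; apply: sume_ge0 => t _; rewrite mule_ge0 // lee_fin ?mulr_ge0.
  - by move=> x; exact: measure_ge0.
  apply: ge_ereal_sup => _ [g /= hg <-]; apply: ereal_sup_ubound; exists g => // x.
  apply: le_trans (hg x) _.
  pose J t : set R := if `|x - Re (c t)| <= h t then I (Im (c t)) (h t) else set0.
  (* The outer measure underlying Lebesgue measure is monotone and subadditive on arbitrary sets,
     hence on the slices of [A]. *)
  pose mu : {outer_measure set (ocitv_type R) -> \bar R} := ((@wlength R idfun)^*)%mu.
  have muE (B : set R) : lebesgue_measure B = mu B by [].
  apply: (@le_trans _ _ (mu (\big[setU/set0]_t J t))).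
    rewrite muE; apply: le_outer_measure => y; rewrite /xsection /= inE /=.
    move=> /Ah[t /= [xt yt]]; rewrite (bigD1 t) //=; left.
    by rewrite /J xt /I set_itvcc /=; move: yt; rewrite ler_norml; lra.
  apply: (@le_trans _ _ (\sum_t mu (J t))%E).
    elim/big_ind2 : _ => [|B b D d hB hD|//]; first by rewrite outer_measure0.
    by apply: le_trans (outer_measureU2 _ _ _) _; exact: leeD.
  apply: lee_sum => t _; rewrite /J; case: ifP => xt.
    have -> : mu (I (Im (c t)) (h t)) = (2 * h t)%:E by exact: lI.
    rewrite indicE mem_set ?mule1 // /I set_itvcc /=.
    by move: xt; rewrite ler_norml; lra.
  by rewrite outer_measure0 mule_ge0 // lee_fin ?mulr_ge0.
rewrite ge0_integral_sum //=.
- rewrite -sumEFin; apply: lee_sum => t _.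
  rewrite ge0_integralZl //=; last by rewrite lee_fin mulr_ge0.
    rewrite [X in (_ * X)%E](_ : _ = (2 * h t)%:E); last first.
      by rewrite integral_indic // setIT; exact: lI.
    rewrite -EFinM lee_fin.
    by rewrite le_eqVlt; apply/orP; left; apply/eqP; ring.
  by apply/measurable_EFinP; exact: measurable_indic.
- by move=> t; apply: measurable_funeM; apply/measurable_EFinP; exact: measurable_indic.
- by move=> t x _; rewrite mule_ge0 // lee_fin ?mulr_ge0.
Qed.

End MeasureBounds.

(** * Small values occur only near zeros *)

Section ZeroSetNeighbourhood.
Variable R : realType.

(** Bisection of [-1, 1]^2 plays the role of compactness: a local [e] exists at every point, and
    four quarters combine by the minimum. *)
Lemma lower_bound_off_zeros (f : C R -> C R) (U : set (C R)) (T : finType)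
    (a : T -> C R) (r : T -> R) :
  @closed_unit_disk R `<=` U -> holomorphic_on U f ->
  (forall t, 0 < r t) ->
  (forall z, closed_unit_disk z -> f z = 0 -> exists t, a t = z) ->
  exists2 e, 0 < e & forall z, closed_unit_disk z -> normc (f z) < e ->
    exists t, normc (z - a t) < r t.
Proof.
move=> DU fh r0 az.
pose P x y s := exists2 e, 0 < e & forall u v, x <= u <= x + s -> y <= v <= y + s ->
  closed_unit_disk (u +i* v) -> normc (f (u +i* v)) < e ->
  exists t, normc ((u +i* v) - a t) < r t.
have [|x y s s0|u v hu hv|e e0 H] := @square_bisection R P (-1) (-1) 2; last first.
- exists e => //; case=> u v uv; apply: H => //.
    by have := normc_Re (u +i* v); have := uv; rewrite /closed_unit_disk /= ler_norml;
      lra.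
  by have := normc_Im (u +i* v); have := uv; rewrite /closed_unit_disk /= ler_norml; lra.
- pose z : C R := u +i* v.
  have close x y s d : 0 < s < d / 2 -> x <= u <= x + s -> y <= v <= y + s ->
      forall u' v', x <= u' <= x + s -> y <= v' <= y + s ->
      normc ((u' +i* v') - z) < d.
    move=> sd xu yv u' v' xu' yv'; apply: le_lt_trans (normc_le_ReIm _) _ => /=.
    have : `|u' - u| <= s by rewrite ler_norml; lra.
    have : `|v' - v| <= s by rewrite ler_norml; lra.
    lra.
  (* Three cases: small squares about a point outside the closed disk miss it, those about a zero
     lie in its neighbourhood, and about any other point |f| stays above half its value. *)
  have [z1|z1] := leP (normc z) 1; last first.
    exists ((normc z - 1) / 2) => [|x y s sd _ _ _ _ xu yv]; first lra.
    exists 1 => // u' v' xu' yv' d1.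
    have : normc z - normc (u' +i* v') < normc z - 1.
      apply: le_lt_trans (normc_subl _ _) _; rewrite normc_distC.
      exact: close sd xu yv _ _ xu' yv'.
    by rewrite ltrD2l ltrN2 ltNge => /negP[].
  have [fz0|fz0] := eqVneq (f z) 0.
    have [t at_] := az z z1 fz0.
    exists (r t / 2) => [|x y s sd _ _ _ _ xu yv]; first by rewrite divr_gt0.
    exists 1 => // u' v' xu' yv' _ _; exists t; rewrite at_.
    exact: close sd xu yv _ _ xu' yv'.
  have nf0 : 0 < normc (f z) / 2 by rewrite divr_gt0 // normc_gt0.
  have [L /cderiv_continuous/(_ _ nf0)[d d0 hd]] := derivable_cderiv (fh z (DU z z1)).
  exists (d / 2) => [|x y s sd _ _ _ _ xu yv]; first by rewrite divr_gt0.
  exists (normc (f z) / 2) => // u' v' xu' yv' _ fe.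
  have := hd _ (close _ _ _ _ sd xu yv _ _ xu' yv'); rewrite normc_distC.
  have := normc_subl (f z) (f (u' +i* v')).
  by move=> h1 h2; have := le_trans h1 h2; lra.
- move=> [e1 e10 H1] [e2 e20 H2] [e3 e30 H3] [e4 e40 H4].
  exists (Order.min (Order.min e1 e2) (Order.min e3 e4)); first
    by rewrite !lt_min e10 e20 e30.
  move=> u v hu hv d1; rewrite !lt_min => /andP[/andP[f1 f2] /andP[f3 f4]].
  have [u1|u1] := leP u (x + s / 2); have [v1|v1] := leP v (y + s / 2).
  + by apply: H1 => //; lra.
  + by apply: H3 => //; lra.
  + by apply: H2 => //; lra.
  + by apply: H4 => //; lra.
- by [].
Qed.

End ZeroSetNeighbourhood.

(** * Global bounds from the local ones *)

Lemma level_sublevel_bounds (R : realType) (f : C R -> C R) (U : set (C R))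
    (T : finType) (a : T -> C R) (k : T -> nat) :
  @closed_unit_disk R `<=` U -> holomorphic_on U f ->
  (forall t, zero_of_multiplicity f (a t) (k t)) ->
  (forall z, closed_unit_disk z -> f z = 0 -> exists t, a t = z) ->
  exists c c' : T -> R, (forall t, 0 < c t /\ 0 < c' t) /\
    exists2 e0 : R, 0 < e0 & forall e, 0 < e -> e < e0 ->
      (hausdorff1 (level_set f e) <=
        (\sum_t c t * e `^ (1 / (k t)%:R))%:E)%E /\
      (area (sublevel_set f e) <=
        (\sum_t c' t * e `^ (2 / (k t)%:R))%:E)%E.
Proof.
move=> DU fh mult az.
have /choice[rK rKP] t : exists rK : R * R, [/\ 0 < rK.1, 0 < rK.2,
    (forall e z, 0 < e -> normc (z - a t) < rK.1 -> normc (f z) <= e ->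
       normc (z - a t) <= rK.2 * e `^ (1 / (k t)%:R)) &
    (forall e z w, 0 < e -> normc (z - a t) < rK.1 -> normc (w - a t) < rK.1 ->
       normc (f z) = e -> normc (f w) = e ->
       normc (z - w) <= 2 * (rK.2 * e `^ (1 / (k t)%:R)) *
         normc ((z - a t) / (normc (z - a t))%:C -
                (w - a t) / (normc (w - a t))%:C))].
  by have [r [K rK]] := level_near_zero (mult t); exists (r, K).
pose r t := (rK t).1; pose K t := (rK t).2.
have r0 t : 0 < r t by have [] := rKP t.
have K0 t : 0 < K t by have [] := rKP t.
have [e1 e10 cover] := lower_bound_off_zeros DU fh r0 az.
(* There are 4 (N + 1) cells of diameter at most 8 rho / N, in total at most 64 rho as N >= 1; a
   square of half-side rho has area 4 rho^2. *)
exists (fun t => 64 * K t), (fun t => 4 * K t ^+ 2); split.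
  by move=> t; rewrite !mulr_gt0 // exprn_gt0.
exists e1 => // e e0 ee1; pose rho t := K t * e `^ (1 / (k t)%:R).
have rho0 t : 0 <= rho t by rewrite mulr_ge0 ?powR_ge0 // ltW.
split; last first.
  have -> : \sum_t 4 * K t ^+ 2 * e `^ (2 / (k t)%:R) = \sum_t 4 * rho t ^+ 2.
    apply: eq_bigr => t _; rewrite /rho exprMn [RHS]mulrA; congr (_ * _).
    by rewrite -powR_mulrn ?powR_ge0 // -powRrM mulrAC mul1r.
  apply: (@area_le R T _ a) => [//|z [z1 fz]].
  have [|t zt] := cover z _ (lt_trans fz ee1); first exact: ltW.
  exists t; have [_ _ /(_ e z e0 zt (ltW fz)) H _] := rKP t.
  have ReB (x y : R[i]) : Re (x - y) = Re x - Re y by case: x; case: y.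
  have ImB (x y : R[i]) : Im (x - y) = Im x - Im y by case: x; case: y.
  split; apply: le_trans H.
    by have := normc_Re (z - a t); rewrite ReB.
  by have := normc_Im (z - a t); rewrite ImB.
apply: hausdorff1_le => d d0.
(* [S] dominates every 8 rho, so a single [N] brings all cell diameters below [d]. *)
pose S := \sum_t 8 * rho t.
have S0 t : 8 * rho t <= S.
  by rewrite /S (bigD1 t) //= lerDl sumr_ge0 // => i _; rewrite mulr_ge0.
pose N := (Num.trunc (S / d)).+1.
have N0 : (0 : R) < N%:R by rewrite ltr0n.
have SN : S <= d * N%:R.
  rewrite -ler_pdivrMl // mulrC.
  have : 0 <= S / d by rewrite divr_ge0 ?(ltW d0) // sumr_ge0 // => i _; rewrite mulr_ge0.
  by move=> /truncn_itv /andP[_ /ltW].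
pose dir (t : T) (z : C R) : R[i] := (z - a t) / (normc (z - a t))%:C.
pose F (i : T * (bool * bool * 'I_N.+1)) : set (C R) :=
  [set z | [/\ normc (z - a i.1) < r i.1, normc (f z) = e &
               dir_cell N (dir i.1 z) = i.2]].
exists (T * (bool * bool * 'I_N.+1))%type, F, (fun i => 8 * rho i.1 / N%:R); split.
- move=> z [z1 fz].
  have [||t zt] := cover z; [exact: ltW|by rewrite fz|].
  by exists (t, dir_cell N (dir t z)).
- move=> [t c]; apply: diam_le => /=.
    by rewrite divr_ge0 // mulr_ge0.
  move=> z w [/= zr fz cz] [/= wr fw cw].
  have [_ _ _ /(_ e z w e0 zr wr fz fw) H] := rKP t.
  (* As e > 0, a point of the level set differs from the zero, so its direction is a unit vector. *)
  have dir1 (y : C R) : normc (f y) = e -> normc (dir t y) = 1.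
    move=> fy; apply: normc_dir; apply/eqP => /subr0_eq yat.
    have [k0 [V [g [oV Va _ _ fE]]]] := mult t.
    move: fy; rewrite yat fE // subrr expr0n eqn0Ngt k0 mul0r normc0 => e00.
    by rewrite -e00 ltxx in e0.
  apply: le_trans H _.
  have -> : 8 * rho t / N%:R = 2 * rho t * (4 / N%:R) by field; rewrite gt_eqF.
  apply: ler_wpM2l; first by rewrite mulr_ge0 // (rho0 t).
  apply: (@dir_cell_close R N (dir t z) (dir t w)) => //; try exact: dir1.
  by rewrite cz.
- by move=> [t c] /=; rewrite ler_pdivrMr //; apply: le_trans SN.
- rewrite -(pair_bigA _ (fun t (_ : bool * bool * 'I_N.+1) => 8 * rho t / N%:R)) /=.
  apply: ler_sum => t _; rewrite sumr_const card_prod card_prod card_bool card_ord.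
  have -> : 64 * K t * e `^ (1 / (k t)%:R) = 64 * rho t by rewrite mulrA.
  rewrite -[leLHS]mulr_natr.
  have N1 : (1 : R) <= N%:R by rewrite ler1n.
  have -> : (2 * 2 * N.+1)%:R = 4 * (N%:R + 1) :> R by rewrite natrM natr1.
  rewrite mulrAC ler_pdivrMr //.
  have : rho t <= rho t * N%:R by rewrite ler_peMr.
  lra.
Qed.

Theorem theorem1p2 (R : realType) (U : set (C R)) (f : C R -> C R)
    (U_open : open U) (U_connected : connected U)
    (U_nbhd : @closed_unit_disk R `<=` U)
    (f_holo : holomorphic_on U f)
    (f_neq0 : exists2 z, U z & f z != 0)
    (f_zero : exists2 z, U z & f z = 0)
    (m : nat) (p : 'I_m -> C R) (k : 'I_m -> nat)
    (p_inj : injective p)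
    (p_zeros : forall z, (exists j, p j = z) <-> unit_disk z /\ f z = 0)
    (p_mult : forall j, zero_of_multiplicity f (p j) (k j))
    (r : nat) (q : 'I_r -> C R) (l : 'I_r -> nat)
    (q_inj : injective q)
    (q_zeros : forall z, (exists nu, q nu = z) <-> unit_circle z /\ f z = 0)
    (q_mult : forall nu, zero_of_multiplicity f (q nu) (l nu)) :
  exists (c c' : 'I_m -> R) (d d' : 'I_r -> R),
    [/\ (forall j, 0 < c j /\ 0 < c' j),
        (forall nu, 0 < d nu /\ 0 < d' nu) &
        exists2 e0 : R, 0 < e0 & forall e : R, 0 < e -> e < e0 ->
          (hausdorff1 (level_set f e) <=
            (\sum_(j < m) c j * e `^ (1 / (k j)%:R) +
             \sum_(nu < r) d nu * e `^ (1 / (l nu)%:R))%:E)%E /\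
          (area (sublevel_set f e) <=
            (\sum_(j < m) c' j * e `^ (2 / (k j)%:R) +
             \sum_(nu < r) d' nu * e `^ (2 / (l nu)%:R))%:E)%E].
Proof.
(* Interior and boundary zeros are treated alike, indexed by a sum type; [big_sumType] separates
   them again. *)
pose a (t : 'I_m + 'I_r) := match t with inl j => p j | inr nu => q nu end.
pose n (t : 'I_m + 'I_r) := match t with inl j => k j | inr nu => l nu end.
have mult t : zero_of_multiplicity f (a t) (n t) by case: t.
have az z : closed_unit_disk z -> f z = 0 -> exists t, a t = z.
  rewrite /closed_unit_disk /= le_eqVlt => /orP[/eqP z1|z1] fz.
    by have [_ /(_ (conj z1 fz))[nu <-]] := q_zeros z; exists (inr nu).
  by have [_ /(_ (conj z1 fz))[j <-]] := p_zeros z; exists (inl j).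
have [c [c' [c0 [e0 e00 H]]]] := level_sublevel_bounds U_nbhd f_holo mult az.
exists (c \o inl), (c' \o inl), (c \o inr), (c' \o inr); split=> [j|nu|]; try exact: c0.
by exists e0 => // e e1 e2; have := H e e1 e2; rewrite !big_sumType.
Qed.
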